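(* For every real $r\ge\frac12$, $\pi_1(S^1,c_r)=\{1\}$.
   Context: A Čech closure space $(X,c)$ is a set $X$ with a map $c:\mathcal{P}(X)\to\mathcal{P}(X)$ such that $c(\emptyset)=\emptyset$, $A\subseteq c(A)$, and $c(A\cup B)=c(A)\cup c(B)$ (not assumed $c^2=c$). A topological space is a closure space via its topological closure. A map $f:(X,c_X)\to(Y,c_Y)$ is continuous iff $f(c_X(A))\subseteq c_Y(f(A))$ for all $A\subseteq X$. $U$ is a neighborhood of $x$ if $x\in X\setminus c(X\setminus U)$. The product closure structure on $X\times Y$ is the one in which, at each point $(x,y)$, the sets $V\times W$ ($V$ a neighborhood of $x$, $W$ a neighborhood of $y$) form a local base of neighborhoods. For a metric space $(X,d)$ and $r\ge 0$, $c_r(A)=\{x\in X\mid d(x,A)\le r\}$, where $d(x,A)=\inf_{y\in A}d(x,y)$ (and $c_r(\emptyset)=\emptyset$). $S^1=\mathbb{R}/\mathbb{Z}$ is the circle of circumference $1$ with the quotient metric $d([x],[y])=\min_{k\in\mathbb{Z}}|x-y+k|$. $I=[0,1]$ has its usual topology. $\pi_1(X,* )$ is the group of homotopy classes rel $\partial I$ of continuous loops $v:I\to(X,c)$ based at $*$ (homotopies are continuous maps $I\times I\to (X,c)$ fixed on $\partial I$), with product given by concatenation; the basepoint is suppressed from the notation. *)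

(* Defs.v *)
From HB Require Import structures.
From mathcomp Require Import all_boot all_order all_algebra.
From mathcomp Require Import ring_quotient lra.
From mathcomp Require Import all_classical all_reals all_analysis.

Set Implicit Arguments.
Unset Strict Implicit.
Unset Printing Implicit Defensive.

Import Order.TTheory GRing.Theory Num.Theory numFieldNormedType.Exports.

Local Open Scope classical_set_scope.
Local Open Scope ring_scope.
Local Open Scope quotient_scope.

(* Cech closure structures; [cl] is not assumed to be idempotent. *)
Record closure_structure (X : Type) := ClosureStructure {
  cl :> set X -> set X ;
  cl0 : cl set0 = set0 ;
  subset_cl : forall A, A `<=` cl A ;
  clU : forall A B, cl (A `|` B) = cl A `|` cl B }.

Definition cl_continuous (X Y : Type)
    (cX : closure_structure X) (cY : closure_structure Y) (f : X -> Y) :=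
  forall A : set X, f @` (cX A) `<=` cY (f @` A).

Definition cl_nbhd (X : Type) (c : closure_structure X) (x : X) (U : set X) :=
  (setT `\` c (setT `\` U)) x.

Section closure_theory.
Context (X : Type) (c : closure_structure X).
Implicit Types (A B U V : set X) (x : X).

Lemma cl_mono A B : A `<=` B -> c A `<=` c B.
Proof. by move=> /setUidPr <-; rewrite clU; exact: subsetUl. Qed.

Lemma cl_nbhdE x U : cl_nbhd c x U <-> ~ c (~` U) x.
Proof. by rewrite /cl_nbhd !setTD. Qed.

Lemma cl_nbhdS x U V : U `<=` V -> cl_nbhd c x U -> cl_nbhd c x V.
Proof.
move=> UV /cl_nbhdE xU; apply/cl_nbhdE => xV; apply: xU.
by apply: cl_mono xV; exact: subsetC.
Qed.

Lemma cl_nbhdI x U V : cl_nbhd c x U -> cl_nbhd c x V -> cl_nbhd c x (U `&` V).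
Proof.
by move=> /cl_nbhdE xU /cl_nbhdE xV; apply/cl_nbhdE; rewrite setCI clU => -[].
Qed.

Lemma cl_nbhdT x : cl_nbhd c x setT.
Proof. by apply/cl_nbhdE; rewrite setCT cl0. Qed.

Lemma cl_nbhd_singleton x U : cl_nbhd c x U -> U x.
Proof. by move=> /cl_nbhdE xU; apply: contrapT => nU; apply/xU/subset_cl. Qed.

Lemma cl_nbhdP A x : c A x <-> forall U, cl_nbhd c x U -> (U `&` A) !=set0.
Proof.
split=> [cAx U /cl_nbhdE xU|h].
  apply/set0P/negP => /eqP UA0; apply/xU/(cl_mono _ cAx) => a Aa Ua.
  by have : set0 a by rewrite -UA0.
apply: contrapT => nA; have [|a []//] := h (~` A).
by apply/cl_nbhdE; rewrite setCK.
Qed.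

End closure_theory.

Lemma cl_continuousP (X Y : Type) (cX : closure_structure X)
    (cY : closure_structure Y) (f : X -> Y) :
  cl_continuous cX cY f <->
  forall x V, cl_nbhd cY (f x) V -> cl_nbhd cX x (f @^-1` V).
Proof.
split=> [fc x V /cl_nbhdE fxV|h A _ [x Ax <-]].
  apply/cl_nbhdE => xV; apply: fxV.
  have : cY (f @` (~` (f @^-1` V))) (f x) by apply: fc; exists x.
  by apply: cl_mono => _ [z /= zV <-].
apply/cl_nbhdP => V /h xV; have [z [Vz Az]] := (cl_nbhdP _ _ _).1 Ax _ xV.
by exists (f z); split => //; exists z.
Qed.

Lemma cl_continuous_comp (X Y Z : Type) (cX : closure_structure X)
    (cY : closure_structure Y) (cZ : closure_structure Z)
    (f : X -> Y) (g : Y -> Z) :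
  cl_continuous cX cY f -> cl_continuous cY cZ g ->
  cl_continuous cX cZ (fun x => g (f x)).
Proof.
by move=> /cl_continuousP fc /cl_continuousP gc; apply/cl_continuousP => x V /gc/fc.
Qed.

Lemma cl_continuous_cst (X Y : Type) (cX : closure_structure X)
    (cY : closure_structure Y) (y : Y) : cl_continuous cX cY (cst y).
Proof.
apply/cl_continuousP => x V yV.
by apply: cl_nbhdS (cl_nbhdT _ _) => z _; exact: cl_nbhd_singleton yV.
Qed.

Lemma cl_continuous_paste (X Y : Type) (cX : closure_structure X)
    (cY : closure_structure Y) (P : pred X) (B : set X) (f g : X -> Y) :
  cX [set x | P x] `<=` [set x | P x] -> cX B `<=` B ->
  (forall x, ~~ P x -> B x) -> (forall x, P x -> B x -> f x = g x) ->
  cl_continuous cX cY f -> cl_continuous cX cY g ->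
  cl_continuous cX cY (fun x => if P x then f x else g x).
Proof.
move=> cP cB PB fg fc gc A _ [x Ax <-].
have : (cX (A `&` [set x | P x]) `|` cX (A `&` B)) x.
  rewrite -clU -setIUr; suff -> : [set x | P x] `|` B = setT by rewrite setIT.
  by apply/seteqP; split => // z _; have [?|/PB] := boolP (P z); [left|right].
case=> xA.
- have Px : P x by apply: cP; apply: cl_mono xA => z [].
  rewrite Px; have : cY (f @` (A `&` [set x | P x])) (f x) by apply: fc; exists x.
  by apply: cl_mono => _ [z [Az /= Pz] <-]; exists z => //; rewrite Pz.
- have Bx : B x by apply: cB; apply: cl_mono xA => z [].
  have -> : (if P x then f x else g x) = g x by case: ifPn => // /fg ->.
  have : cY (g @` (A `&` B)) (g x) by apply: gc; exists x.
  apply: cl_mono => _ [z [Az Bz] <-]; exists z => //.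
  by case: ifPn => // /fg ->.
Qed.

Section topological_closure.
Context (T : topologicalType).

Lemma top_cl_subproof (A : set T) : A `<=` closure A.
Proof. exact: subset_closure. Qed.

Definition top_cl : closure_structure T :=
  @ClosureStructure T closure (closure0 T) top_cl_subproof (@closureU T).

Lemma top_cl_nbhdE (x : T) U : cl_nbhd top_cl x U <-> nbhs x U.
Proof. by rewrite cl_nbhdE -[nbhs x U]/(U° x) -{2}[U]setCK interiorC. Qed.

End topological_closure.

Lemma top_cl_continuous (T U : topologicalType) (f : T -> U) :
  continuous f -> cl_continuous (top_cl T) (top_cl U) f.
Proof.
by move=> fc; apply/cl_continuousP => x V /top_cl_nbhdE/fc ?; apply/top_cl_nbhdE.
Qed.

Section product_closure.
Context (X Y : Type) (cX : closure_structure X) (cY : closure_structure Y).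

Definition prod_cl_fun (A : set (X * Y)) : set (X * Y) :=
  [set p | forall V W, cl_nbhd cX p.1 V -> cl_nbhd cY p.2 W ->
                       ((V `*` W) `&` A) !=set0].

Lemma prod_cl_fun0 : prod_cl_fun set0 = set0.
Proof.
apply/seteqP; split => // p h.
by have [z []] := h _ _ (cl_nbhdT _ _) (cl_nbhdT _ _).
Qed.

Lemma subset_prod_cl_fun A : A `<=` prod_cl_fun A.
Proof.
move=> p Ap V W pV pW; exists p; split => //.
by split; [exact: cl_nbhd_singleton pV|exact: cl_nbhd_singleton pW].
Qed.

Lemma prod_cl_funU A B :
  prod_cl_fun (A `|` B) = prod_cl_fun A `|` prod_cl_fun B.
Proof.
apply/seteqP; split=> [p|p [] pA V W pV pW]; last first.
- by have [z [? ?]] := pA _ _ pV pW; exists z; split => //; right.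
- by have [z [? ?]] := pA _ _ pV pW; exists z; split => //; left.
move=> pAB; apply: contrapT => /not_orP[].
move=> /existsNP[V /existsNP[W /not_implyP[pV /not_implyP[pW nA]]]].
move=> /existsNP[V' /existsNP[W' /not_implyP[pV' /not_implyP[pW' nB]]]].
have [z [[[Vz V'z] [Wz W'z]] [Az|Bz]]] :=
  pAB _ _ (cl_nbhdI pV pV') (cl_nbhdI pW pW').
- by apply: nA; exists z.
- by apply: nB; exists z.
Qed.

Definition prod_cl : closure_structure (X * Y) :=
  ClosureStructure prod_cl_fun0 subset_prod_cl_fun prod_cl_funU.

(* A neighborhood system determines the closure ([cl_nbhdP]), so this local base
   of boxes characterizes [prod_cl]. *)
Lemma cl_nbhd_prodP (p : X * Y) (U : set (X * Y)) :
  cl_nbhd prod_cl p U <->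
  exists V W, [/\ cl_nbhd cX p.1 V, cl_nbhd cY p.2 W & V `*` W `<=` U].
Proof.
split=> [/cl_nbhdE|[V [W [pV pW VWU]]]].
  move=> /existsNP[V /existsNP[W /not_implyP[pV /not_implyP[pW nA]]]].
  exists V, W; split => // z VWz; apply: contrapT => nU.
  by apply: nA; exists z.
by apply/cl_nbhdE => /(_ _ _ pV pW)[z [/VWU]].
Qed.

Lemma cl_continuous_fst : cl_continuous prod_cl cX fst.
Proof.
apply/cl_continuousP => p V pV; apply/cl_nbhd_prodP.
by exists V, setT; split => //; [exact: cl_nbhdT|move=> z []].
Qed.

Lemma cl_continuous_snd : cl_continuous prod_cl cY snd.
Proof.
apply/cl_continuousP => p V pV; apply/cl_nbhd_prodP.
by exists setT, V; split => //; [exact: cl_nbhdT|move=> z []].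
Qed.

Lemma cl_continuous_pair (Z : Type) (cZ : closure_structure Z)
    (f : Z -> X) (g : Z -> Y) :
  cl_continuous cZ cX f -> cl_continuous cZ cY g ->
  cl_continuous cZ prod_cl (fun z => (f z, g z)).
Proof.
move=> /cl_continuousP fc /cl_continuousP gc; apply/cl_continuousP => z U.
move=> /cl_nbhd_prodP[V [W [/fc zV /gc zW VWU]]].
by apply: cl_nbhdS (cl_nbhdI zV zW) => y [? ?]; exact: VWU.
Qed.

End product_closure.

Lemma prod_cl_topE (T U : topologicalType) (p : T * U) (A : set (T * U)) :
  cl_nbhd (prod_cl (top_cl T) (top_cl U)) p A <-> cl_nbhd (top_cl (T * U)%type) p A.
Proof.
split=> [/cl_nbhd_prodP[V [W [/top_cl_nbhdE pV /top_cl_nbhdE pW VWA]]]|].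
  by apply/top_cl_nbhdE; exists (V, W).
move=> /top_cl_nbhdE[[V W] [/= pV pW] VWA]; apply/cl_nbhd_prodP; exists V, W.
by split => //; apply/top_cl_nbhdE.
Qed.

Section metric_closure.
Context (R : realType) (X : metricType R).

Definition dist_set (x : X) (A : set X) : R := inf [set mdist x y | y in A].

Definition metric_cl_fun (r : R) (A : set X) : set X :=
  [set x | A !=set0 /\ dist_set x A <= r].

Let dist_lb (x : X) (A : set X) : has_lbound [set mdist x y | y in A].
Proof. by exists 0 => _ [y _ <-]; exact: mdist_ge0. Qed.

Lemma metric_cl_fun0 (r : R) : metric_cl_fun r set0 = set0.
Proof. by apply/seteqP; split => // x [[]]. Qed.

Lemma subset_metric_cl_fun (r : {nonneg R}) A : A `<=` metric_cl_fun r%:num A.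
Proof.
move=> x Ax; split; first by exists x.
by rewrite (le_trans _ (ge0 r))// -(mdistxx x); apply: ge_inf => //; exists x.
Qed.

Lemma metric_cl_funU (r : R) A B :
  metric_cl_fun r (A `|` B) = metric_cl_fun r A `|` metric_cl_fun r B.
Proof.
have mono C D : C `<=` D -> metric_cl_fun r C `<=` metric_cl_fun r D.
  move=> CD x [[y Cy] xr]; split; first by exists y; exact: CD.
  apply: le_trans xr; apply: lb_le_inf; first by exists (mdist x y), y.
  by move=> _ [z Cz <-]; apply: ge_inf => //; exists z => //; exact: CD.
apply/seteqP; split=> [x [[y ABy] xr]|x [] xr]; first last.
- by apply: mono xr; exact: subsetUr.
- by apply: mono xr; exact: subsetUl.
apply: contrapT => /not_orP[nA nB].
have far C : ~ metric_cl_fun r C x -> exists2 e, r < e &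
    forall z, C z -> e <= mdist x z.
  move=> nC; have [[z Cz]|C0] := pselect (C !=set0); last first.
    by exists (r + 1); [rewrite ltrDl|move=> z Cz; case: C0; exists z].
  exists (dist_set x C).
    by rewrite ltNge; apply/negP => xC; apply: nC; split => //; exists z.
  by move=> t Ct; apply: ge_inf => //; exists t.
have [e re eA] := far _ nA; have [e' re' eB] := far _ nB.
have : Num.min e e' <= dist_set x (A `|` B).
  apply: lb_le_inf; first by exists (mdist x y), y.
  by move=> _ [z [/eA|/eB] h <-]; rewrite ge_min h ?orbT.
by move=> /le_trans/(_ xr); rewrite ge_min !leNgt re re'.
Qed.

Definition metric_cl (r : {nonneg R}) : closure_structure X :=
  ClosureStructure (metric_cl_fun0 r%:num) (@subset_metric_cl_fun r)
    (metric_cl_funU r%:num).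

End metric_closure.

Section circle.
Context (R : realType).

(* The quotient of the additive group of R by the subgroup of integers. *)
Definition circle : Type := 
  Quotient.quot (GRing.ZmodClosed.clone R Num.int_num_subdef _).

HB.instance Definition _ := GRing.Zmodule.on circle.
HB.instance Definition _ := EqQuotient.on circle.

Lemma circle_eqP (x y : R) :
  reflect (exists k : int, x - y = k%:~R) (x == y %[mod circle]).
Proof. by rewrite -Quotient.idealrBE; exact: intrP. Qed.

Definition circle_dist (a b : circle) : R :=
  inf (range (fun k : int => `|repr a - repr b + k%:~R|)).

Let circle_lb (z : R) : has_lbound (range (fun k : int => `|z + k%:~R|)).
Proof. by exists 0 => _ [k _ <-]. Qed.

Let circle_min (z : R) :
  exists k : int, inf (range (fun k : int => `|z + k%:~R|)) = `|z + k%:~R|.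
Proof.
suff [k kP] : exists k : int, forall j : int, `|z + k%:~R| <= `|z + j%:~R|.
  exists k; apply/eqP; rewrite eq_le; apply/andP; split.
    by apply: ge_inf => //; exists k.
  apply: lb_le_inf; first by exists (`|z + k%:~R|), k.
  by move=> _ [j _ <-].
pose f := z - (Num.floor z)%:~R.
have f0 : 0 <= f by rewrite subr_ge0 floor_le_tmp.
have f1 : f < 1 by rewrite ltrBlDl -intrD1 floorD1_gt.
have zj (j : int) : z + j%:~R = f + (Num.floor z + j)%:~R.
  by rewrite intrD addrA subrK.
have hj (j : int) : f <= `|f + j%:~R| \/ 1 - f <= `|f + j%:~R|.
  have [j0|j0] := leP 0 j.
    by left; have := j0; rewrite -(ler0z R) => ?; rewrite ger0_norm; lra.
  right; have : j + 1 <= 0 by rewrite lezD1.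
  by rewrite -(ler_int R) intrD => ?; rewrite ltr0_norm; lra.
have [f2|f2] := leP f (1 - f).
  exists (- Num.floor z) => j; rewrite !zj subrr addr0 ger0_norm//.
  by case: (hj (Num.floor z + j)) => h; lra.
exists (- Num.floor z - 1) => j; rewrite !zj addrA subrr add0r mulrN1z.
rewrite ltr0_norm ?subr_lt0//.
by case: (hj (Num.floor z + j)) => h; lra.
Qed.

(* Independence of the representatives. *)
Lemma circle_dist_pi (x y : R) :
  circle_dist (\pi x) (\pi y) = inf (range (fun k : int => `|x - y + k%:~R|)).
Proof.
have [i ix] : exists i : int, repr (\pi_circle x) - x = i%:~R.
  by apply/circle_eqP; rewrite reprK.
have [j jy] : exists j : int, repr (\pi_circle y) - y = j%:~R.
  by apply/circle_eqP; rewrite reprK.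
congr inf; apply/seteqP; split => _ [k _ <-] /=.
  exists (i - j + k) => //; congr `|_|; rewrite !intrD intrN -ix -jy; lra.
exists (k - i + j) => //; congr `|_|; rewrite !intrD intrN -ix -jy; lra.
Qed.

(* The infimum is a minimum. *)
Lemma circle_dist_min (x y : R) :
  (exists k : int, circle_dist (\pi x) (\pi y) = `|x - y + k%:~R|) /\
  (forall k : int, circle_dist (\pi x) (\pi y) <= `|x - y + k%:~R|).
Proof.
rewrite circle_dist_pi; split; first exact: circle_min.
by move=> k; apply: ge_inf => //; exists k.
Qed.

Let circle_distxx a : circle_dist a a = 0.
Proof.
rewrite -(reprK a); have [[k kE] /(_ 0)] := circle_dist_min (repr a) (repr a).
rewrite subrr addr0 normr0 => le0; apply/eqP; rewrite eq_le le0/=.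
by rewrite kE normr_ge0.
Qed.

Let circle_dist_positivity a b : circle_dist a b = 0 -> a = b.
Proof.
rewrite -{1}(reprK a) -{1}(reprK b).
have [[k ->] _] := circle_dist_min (repr a) (repr b).
move=> /normr0_eq0 abk; rewrite -[a]reprK -[b]reprK; apply/eqP/circle_eqP.
by exists (- k); rewrite mulrNz; apply/eqP; rewrite -addr_eq0 abk.
Qed.

Let circle_dist_sym a b : circle_dist a b = circle_dist b a.
Proof.
suff le c d : circle_dist c d <= circle_dist d c by apply/eqP; rewrite eq_le !le.
rewrite -(reprK c) -(reprK d).
have [[k ->] _] := circle_dist_min (repr d) (repr c).
have [_ /(_ (- k))] := circle_dist_min (repr c) (repr d).
by rewrite mulrNz -[repr c - _]opprB -opprD normrN.
Qed.

Let circle_dist_triangle b a c :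
  circle_dist a c <= circle_dist a b + circle_dist b c.
Proof.
rewrite -(reprK a) -(reprK b) -(reprK c).
have [[k ->] _] := circle_dist_min (repr a) (repr b).
have [[l ->] _] := circle_dist_min (repr b) (repr c).
have [_ /(_ (k + l)) h] := circle_dist_min (repr a) (repr c).
apply: le_trans h (le_trans _ (ler_normD _ _)).
by rewrite intrD le_eqVlt; apply/orP; left; apply/eqP; congr `|_|; lra.
Qed.

HB.instance Definition _ := @isMetric.Build R circle circle_dist circle_distxx
  circle_dist_positivity circle_dist_sym circle_dist_triangle.

Lemma circle_mdistE (x y : R) :
  mdist (\pi_circle x) (\pi_circle y) =
  inf (range (fun k : int => `|x - y + k%:~R|)).
Proof. exact: circle_dist_pi. Qed.

End circle.

Section unit_interval.
Context (R : realType).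

(* The subtype of R, with the subspace topology. *)
Definition unitI : Type := `[0%R : R, 1%R]%classic.

HB.instance Definition _ := Topological.on unitI.

Definition unitI_cl : closure_structure unitI := top_cl unitI.

Definition unitI_val (s : unitI) : R := set_val s.

Let clamp_subproof (t : R) : Num.max 0 (Num.min 1 t) \in `[0%R : R, 1%R]%classic.
Proof.
by apply/mem_set; rewrite /= in_itv/= le_max lexx/= ge_max ler01 ge_min lexx.
Qed.

(* The retraction of R onto [0, 1]. *)
Definition clamp (t : R) : unitI := 
  exist (fun x => x \in `[0%R : R, 1%R]%classic) _ (clamp_subproof t).

Definition I0 : unitI := clamp 0.
Definition I1 : unitI := clamp 1.

Lemma unitI_itv (s : unitI) : 0 <= unitI_val s <= 1.
Proof. by have := set_mem (valP s); rewrite /= in_itv. Qed.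

Lemma unitI_inj (s t : unitI) : unitI_val s = unitI_val t -> s = t.
Proof. exact: val_inj. Qed.

Lemma clampE (t : R) : unitI_val (clamp t) = Num.max 0 (Num.min 1 t).
Proof. by []. Qed.

Lemma clampK (t : R) : 0 <= t <= 1 -> unitI_val (clamp t) = t.
Proof. by move=> /andP[t0 t1]; rewrite clampE min_r// max_r. Qed.

Lemma unitI_valK : cancel unitI_val clamp.
Proof. by move=> s; apply: unitI_inj; rewrite clampK// unitI_itv. Qed.

Lemma I0E : unitI_val I0 = 0.
Proof. by rewrite clampK// lexx ler01. Qed.

Lemma I1E : unitI_val I1 = 1.
Proof. by rewrite clampK// lexx ler01. Qed.

Lemma clamp_le0 (t : R) : t <= 0 -> clamp t = I0.
Proof.
move=> t0; apply: unitI_inj; rewrite I0E clampE min_r ?(le_trans t0)//.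
by rewrite max_l.
Qed.

Lemma clamp_ge1 (t : R) : 1 <= t -> clamp t = I1.
Proof.
by move=> t1; apply: unitI_inj; rewrite I1E clampE min_l// max_r.
Qed.

Lemma unitI_val_continuous : continuous unitI_val.
Proof. exact: initial_continuous. Qed.

Lemma clamp_continuous : continuous clamp.
Proof.
apply: continuous_comp_initial => t.
apply: (@continuous_max R R^o (cst 0) (fun u => Num.min 1 u)); first exact: cvg_cst.
by apply: (@continuous_min R R^o (cst 1) id); [exact: cvg_cst|exact: cvg_id].
Qed.

End unit_interval.

Arguments I0 {R}.
Arguments I1 {R}.

Section loops.
Context (R : realType) (X : Type) (c : closure_structure X) (x : X).

Local Notation I := (unitI R).
Local Notation cI := (unitI_cl R).
Local Notation cII := (prod_cl cI cI).

Record loop := Loop {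
  loop_fun :> I -> X ;
  loop_continuous : cl_continuous cI c loop_fun ;
  loop0 : loop_fun I0 = x ;
  loop1 : loop_fun I1 = x }.

Arguments loop_continuous : clear implicits.

Definition loop_homotopy (f g : loop) (H : I * I -> X) :=
  [/\ cl_continuous cII c H,
      forall s, H (s, I0) = f s,
      forall s, H (s, I1) = g s &
      forall t, H (I0, t) = x /\ H (I1, t) = x].

Definition loop_homotopic (f g : loop) := exists H, loop_homotopy f g H.

Definition loop_cst : loop := Loop (@cl_continuous_cst _ _ cI c x) erefl erefl.

Definition concat_fun (f g : I -> X) (s : I) : X :=
  if unitI_val s <= 2^-1 then f (clamp (2 * unitI_val s))
  else g (clamp (2 * unitI_val s - 1)).

Definition rev_fun (f : I -> X) (s : I) : X := f (clamp (1 - unitI_val s)).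

Let reparamI_continuous (phi : R -> R) : continuous phi ->
  cl_continuous cI cI (fun s => clamp (phi (unitI_val s))).
Proof.
move=> phic; apply: top_cl_continuous => s.
apply: (continuous_comp (f := phi \o @unitI_val R) (g := @clamp R)); last first.
  exact: clamp_continuous.
by apply: continuous_comp; [exact: unitI_val_continuous|exact: phic].
Qed.

Let affine_continuous (a b : R) : continuous (fun t : R => a * t - b).
Proof.
move=> t; apply: (@continuousB R R^o R) => /=; last exact: cvg_cst.
by apply: (@continuousM R R) => /=; [exact: cvg_cst|exact: cvg_id].
Qed.

Let scale_continuous (a : R) : continuous (fun t : R => a * t).
Proof. by move=> t; apply: (@continuousM R R) => /=; [exact: cvg_cst|exact: cvg_id]. Qed.

Let rev_continuous : continuous (fun t : R => 1 - t).
Proof.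
by move=> t; apply: (@continuousB R R^o R) => /=; [exact: cvg_cst|exact: cvg_id].
Qed.

Let half_closed : cI [set s | unitI_val s <= 2^-1] `<=` [set s | unitI_val s <= 2^-1].
Proof.
suff : closed (@unitI_val R @^-1` [set t | t <= 2^-1]) by [].
apply: preimage_closed; last exact: closed_le.
by move=> s _; exact: unitI_val_continuous.
Qed.

Let half_closed' : cI [set s | 2^-1 <= unitI_val s] `<=` [set s | 2^-1 <= unitI_val s].
Proof.
suff : closed (@unitI_val R @^-1` [set t | 2^-1 <= t]) by [].
apply: preimage_closed; last exact: closed_ge.
by move=> s _; exact: unitI_val_continuous.
Qed.

(* Pasting along a coordinate u : Z -> I. *)
Let paste_half (Z : Type) (cZ : closure_structure Z) (u : Z -> I) (f g : Z -> X) :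
  cl_continuous cZ cI u ->
  (forall z, unitI_val (u z) = 2^-1 -> f z = g z) ->
  cl_continuous cZ c f -> cl_continuous cZ c g ->
  cl_continuous cZ c (fun z => if unitI_val (u z) <= 2^-1 then f z else g z).
Proof.
move=> uc fg fc gc.
apply: (@cl_continuous_paste _ _ cZ c (fun z => unitI_val (u z) <= 2^-1)
         [set z | 2^-1 <= unitI_val (u z)]) => //.
- move=> z zle; apply: half_closed.
  have : cI (u @` [set z | unitI_val (u z) <= 2^-1]) (u z) by apply: uc; exists z.
  by apply: cl_mono => _ [y ? <-].
- move=> z zle; apply: half_closed'.
  have : cI (u @` [set z | 2^-1 <= unitI_val (u z)]) (u z) by apply: uc; exists z.
  by apply: cl_mono => _ [y ? <-].
- by move=> z; rewrite -ltNge => /ltW.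
- by move=> z zle zge; apply: fg; apply/eqP; rewrite eq_le zle.
Qed.

Let cl_continuous_id : cl_continuous cI cI id.
Proof. by move=> A _ [s As <-]; rewrite image_id. Qed.

Lemma concat_continuous (f g : loop) : cl_continuous cI c (concat_fun f g).
Proof.
apply: (@paste_half _ cI id (fun s => f (clamp (2 * unitI_val s)))
         (fun s => g (clamp (2 * unitI_val s - 1)))).
- exact: cl_continuous_id.
- by move=> s ->; rewrite divff// subrr -/I0 -/I1 loop0 loop1.
- exact: (cl_continuous_comp (reparamI_continuous (@scale_continuous 2))
    (loop_continuous f)).
- exact: (cl_continuous_comp (reparamI_continuous (@affine_continuous 2 1))
    (loop_continuous g)).
Qed.

Lemma concat0 (f g : loop) : concat_fun f g I0 = x.
Proof. by rewrite /concat_fun I0E invr_ge0 ler0n mulr0 -/I0 loop0. Qed.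

Lemma concat1 (f g : loop) : concat_fun f g I1 = x.
Proof.
rewrite /concat_fun I1E ifF; last lra.
by rewrite (_ : 2 * 1 - 1 = 1) -/I1 ?loop1//; lra.
Qed.

Definition loop_concat (f g : loop) : loop :=
  Loop (@concat_continuous f g) (concat0 f g) (concat1 f g).

Lemma rev_fun_continuous (f : loop) : cl_continuous cI c (rev_fun f).
Proof.
exact: (cl_continuous_comp (reparamI_continuous rev_continuous) (loop_continuous f)).
Qed.

Lemma rev_fun0 (f : loop) : rev_fun f I0 = x.
Proof. by rewrite /rev_fun I0E subr0 -/I1 loop1. Qed.

Lemma rev_fun1 (f : loop) : rev_fun f I1 = x.
Proof. by rewrite /rev_fun I1E subrr -/I0 loop0. Qed.

Definition loop_rev (f : loop) : loop :=
  Loop (@rev_fun_continuous f) (rev_fun0 f) (rev_fun1 f).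

(* Two reparametrizations of a loop with the same endpoints are homotopic. *)
Lemma reparam_homotopic (f g h : loop) (phi psi : R -> R) :
  continuous phi -> continuous psi -> phi 0 = psi 0 -> phi 1 = psi 1 ->
  (forall s, g s = f (clamp (phi (unitI_val s)))) ->
  (forall s, h s = f (clamp (psi (unitI_val s)))) -> loop_homotopic g h.
Proof.
move=> phic psic e0 e1 gE hE.
pose K (p : I * I) := clamp ((1 - unitI_val p.2) * phi (unitI_val p.1) +
                             unitI_val p.2 * psi (unitI_val p.1)).
have Kc : continuous K.
  move=> p; pose k (q : I * I) := (1 - unitI_val q.2) * phi (unitI_val q.1) +
                                  unitI_val q.2 * psi (unitI_val q.1).
  apply: (@continuous_comp (I * I)%type R I k (@clamp R)); last first.
    exact: clamp_continuous.
  have v1 : {for p, continuous (fun p : I * I => unitI_val p.1)}.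
    apply: (@continuous_comp (I * I)%type I R fst (@unitI_val R)).
      exact: cvg_fst.
    exact: unitI_val_continuous.
  have v2 : {for p, continuous (fun p : I * I => unitI_val p.2)}.
    apply: (@continuous_comp (I * I)%type I R snd (@unitI_val R)).
      exact: cvg_snd.
    exact: unitI_val_continuous.
  apply: (@continuousD R R^o (I * I)%type) => /=.
    apply: (@continuousM R (I * I)%type) => /=.
      by apply: (@continuousB R R^o (I * I)%type) => /=; [exact: cvg_cst|exact: v2].
    by apply: (@continuous_comp (I * I)%type R R _ phi); [exact: v1|exact: phic].
  apply: (@continuousM R (I * I)%type) => /=; first exact: v2.
  by apply: (@continuous_comp (I * I)%type R R _ psi); [exact: v1|exact: psic].
have Kcl : cl_continuous cII cI K.
  apply/cl_continuousP => p V /top_cl_nbhdE/Kc pV.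
  by apply/prod_cl_topE/top_cl_nbhdE.
exists (f \o K); split => [|s|s|t] /=.
- exact: (cl_continuous_comp Kcl (loop_continuous f)).
- by rewrite gE /K /= I0E subr0 mul1r mul0r addr0.
- by rewrite hE /K /= I1E subrr mul1r mul0r add0r.
- rewrite /K /= I0E I1E -e0 -e1 -!mulrDl !subrK !mul1r; split.
  + by rewrite -I0E -gE loop0.
  + by rewrite -I1E -gE loop1.
Qed.

Lemma loop_homotopic_refl (f : loop) : loop_homotopic f f.
Proof.
exists (f \o fst); split => [|//|//|t] /=; last by rewrite loop0 loop1.
exact: (cl_continuous_comp (@cl_continuous_fst _ _ _ _) (loop_continuous f)).
Qed.

Lemma loop_homotopic_sym (f g : loop) : loop_homotopic f g -> loop_homotopic g f.
Proof.
move=> [H [Hc H0 H1 Hb]].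
exists (fun p => H (p.1, clamp (1 - unitI_val p.2))); split => [|s|s|t] /=.
- apply: (@cl_continuous_comp _ _ _ _ cII _
    (fun p => (p.1, clamp (1 - unitI_val p.2)))) Hc.
  apply: cl_continuous_pair; first exact: cl_continuous_fst.
  exact: (cl_continuous_comp (@cl_continuous_snd _ _ cI cI)
    (reparamI_continuous rev_continuous)).
- by rewrite I0E subr0 -/I1 H1.
- by rewrite I1E subrr -/I0 H0.
- exact: Hb.
Qed.

Lemma loop_homotopic_trans (g f h : loop) :
  loop_homotopic f g -> loop_homotopic g h -> loop_homotopic f h.
Proof.
move=> [F [Fc F0 F1 Fb]] [G [Gc G0 G1 Gb]].
exists (fun p => if unitI_val p.2 <= 2^-1 then F (p.1, clamp (2 * unitI_val p.2))
                 else G (p.1, clamp (2 * unitI_val p.2 - 1))).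
split => [|s|s|t] /=.
- apply: (@paste_half _ cII snd (fun p => F (p.1, clamp (2 * unitI_val p.2)))
    (fun p => G (p.1, clamp (2 * unitI_val p.2 - 1)))).
  + exact: cl_continuous_snd.
  + by move=> s ->; rewrite divff// subrr F1 G0.
  + apply: (@cl_continuous_comp _ _ _ _ cII _
      (fun p => (p.1, clamp (2 * unitI_val p.2)))) Fc.
    apply: cl_continuous_pair; first exact: cl_continuous_fst.
    exact: (cl_continuous_comp (@cl_continuous_snd _ _ cI cI)
      (reparamI_continuous (@scale_continuous 2))).
  + apply: (@cl_continuous_comp _ _ _ _ cII _
      (fun p => (p.1, clamp (2 * unitI_val p.2 - 1)))) Gc.
    apply: cl_continuous_pair; first exact: cl_continuous_fst.
    exact: (cl_continuous_comp (@cl_continuous_snd _ _ cI cI)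
      (reparamI_continuous (@affine_continuous 2 1))).
- by rewrite I0E invr_ge0 ler0n mulr0 F0.
- rewrite I1E ifF; last lra.
  by rewrite (_ : 2 * 1 - 1 = 1) ?G1//; lra.
- by case: ifP => _; [exact: Fb|exact: Gb].
Qed.

Lemma concat_homotopic (f f' g g' : loop) :
  loop_homotopic f f' -> loop_homotopic g g' ->
  loop_homotopic (loop_concat f g) (loop_concat f' g').
Proof.
move=> [F [Fc F0 F1 Fb]] [G [Gc G0 G1 Gb]].
exists (fun p => if unitI_val p.1 <= 2^-1 then F (clamp (2 * unitI_val p.1), p.2)
                 else G (clamp (2 * unitI_val p.1 - 1), p.2)).
split => [|s|s|t] /=.
- apply: (@paste_half _ cII fst (fun p => F (clamp (2 * unitI_val p.1), p.2))
    (fun p => G (clamp (2 * unitI_val p.1 - 1), p.2))).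
  + exact: cl_continuous_fst.
  + by move=> s ->; rewrite divff// subrr (Fb _).2 (Gb _).1.
  + apply: (@cl_continuous_comp _ _ _ _ cII _
      (fun p => (clamp (2 * unitI_val p.1), p.2))) Fc.
    apply: cl_continuous_pair; last exact: cl_continuous_snd.
    exact: (cl_continuous_comp (@cl_continuous_fst _ _ cI cI)
      (reparamI_continuous (@scale_continuous 2))).
  + apply: (@cl_continuous_comp _ _ _ _ cII _
      (fun p => (clamp (2 * unitI_val p.1 - 1), p.2))) Gc.
    apply: cl_continuous_pair; last exact: cl_continuous_snd.
    exact: (cl_continuous_comp (@cl_continuous_fst _ _ cI cI)
      (reparamI_continuous (@affine_continuous 2 1))).
- by rewrite /concat_fun; case: ifP; rewrite (F0, G0).
- by rewrite /concat_fun; case: ifP; rewrite (F1, G1).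
- rewrite I0E I1E invr_ge0 ler0n mulr0 (Fb _).1 ifF; last lra.
  by rewrite (_ : 2 * 1 - 1 = 1) ?(Gb _).2//; lra.
Qed.

Lemma rev_homotopic (f f' : loop) :
  loop_homotopic f f' -> loop_homotopic (loop_rev f) (loop_rev f').
Proof.
move=> [F [Fc F0 F1 Fb]].
exists (fun p => F (clamp (1 - unitI_val p.1), p.2)); split => [|s|s|t] /=.
- apply: (@cl_continuous_comp _ _ _ _ cII _
    (fun p => (clamp (1 - unitI_val p.1), p.2))) Fc.
  apply: cl_continuous_pair; last exact: cl_continuous_snd.
  exact: (cl_continuous_comp (@cl_continuous_fst _ _ cI cI)
    (reparamI_continuous rev_continuous)).
- by rewrite F0.
- by rewrite F1.
- by rewrite I0E I1E subr0 subrr (Fb _).1 (Fb _).2.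
Qed.

Let continuous_minR (f g : R -> R) : continuous f -> continuous g ->
  continuous (fun t => Num.min (f t) (g t)).
Proof. by move=> fc gc t; apply: (@continuous_min R R f g); [exact: fc|exact: gc]. Qed.

Let continuous_maxR (f g : R -> R) : continuous f -> continuous g ->
  continuous (fun t => Num.max (f t) (g t)).
Proof. by move=> fc gc t; apply: (@continuous_max R R f g); [exact: fc|exact: gc]. Qed.

Let id_continuous : continuous (fun t : R => t).
Proof. by move=> t; exact: cvg_id. Qed.

Let cst_continuousR (a : R) : continuous (fun t : R => a).
Proof. by move=> t; exact: cvg_cst. Qed.

Lemma concat_cstl (f : loop) : loop_homotopic (loop_concat loop_cst f) f.
Proof.
apply: (@reparam_homotopic f _ _ (fun t => Num.max 0 (2 * t - 1)) id).
- exact: continuous_maxR (@cst_continuousR 0) (@affine_continuous 2 1).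
- exact: id_continuous.
- by rewrite max_l//; lra.
- by rewrite max_r; lra.
- move=> s /=; rewrite /concat_fun; case: ifP => s2.
    by rewrite max_l ?loop0//; lra.
  by rewrite max_r//; lra.
- by move=> s; rewrite unitI_valK.
Qed.

Lemma concat_cstr (f : loop) : loop_homotopic (loop_concat f loop_cst) f.
Proof.
apply: (@reparam_homotopic f _ _ (fun t => Num.min 1 (2 * t)) id).
- exact: continuous_minR (@cst_continuousR 1) (@scale_continuous 2).
- exact: id_continuous.
- by rewrite min_r; lra.
- by rewrite min_l//; lra.
- move=> s /=; rewrite /concat_fun; case: ifP => s2.
    by rewrite min_r//; lra.
  by rewrite min_l ?loop1//; lra.
- by move=> s; rewrite unitI_valK.
Qed.

Lemma concat_revr (f : loop) :
  loop_homotopic (loop_concat f (loop_rev f)) loop_cst.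
Proof.
apply: (@reparam_homotopic f _ _
  (fun t => Num.min (2 * t) (1 - (2 * t - 1))) (fun=> 0)).
- apply: continuous_minR; first exact: scale_continuous.
  move=> t; exact: (@continuous_comp R R R (fun u => 2 * u - 1) (fun u => 1 - u) t
    (@affine_continuous 2 1 t) (@rev_continuous _)).
- exact: cst_continuousR.
- by rewrite min_l; lra.
- by rewrite min_r; lra.
- move=> s /=; have /andP[s0 s1] := unitI_itv s.
  rewrite /concat_fun; case: ifP => s2; first by rewrite min_l//; lra.
  by rewrite /rev_fun clampK ?min_r//; lra.
- by move=> s; rewrite -/I0 loop0.
Qed.

Lemma loop_revK (f : loop) (s : I) : loop_rev (loop_rev f) s = f s.
Proof.
rewrite /= /rev_fun; have /andP[s0 s1] := unitI_itv s.
by rewrite clampK ?subKr ?unitI_valK//; lra.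
Qed.

Lemma concat_revl (f : loop) :
  loop_homotopic (loop_concat (loop_rev f) f) loop_cst.
Proof.
apply: (@reparam_homotopic f _ _
  (fun t => Num.max (1 - 2 * t) (2 * t - 1)) (fun=> 1)).
- apply: continuous_maxR; last exact: affine_continuous.
  move=> t; exact: (@continuous_comp R R R (fun u => 2 * u) (fun u => 1 - u) t
    (@scale_continuous 2 t) (@rev_continuous _)).
- exact: cst_continuousR.
- by rewrite max_l; lra.
- by rewrite max_r; lra.
- move=> s /=; have /andP[s0 s1] := unitI_itv s.
  rewrite /concat_fun; case: ifP => s2; last by rewrite max_r//; lra.
  by rewrite /rev_fun clampK ?max_l//; lra.
- by move=> s; rewrite -/I1 loop1.
Qed.

Lemma concatA (f g h : loop) :
  loop_homotopic (loop_concat f (loop_concat g h))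
                 (loop_concat (loop_concat f g) h).
Proof.
pose phi (t : R) := Num.min (2 * t) (Num.min (1 * t - - 4^-1) (2^-1 * t - - 2^-1)).
apply: (@reparam_homotopic (loop_concat f (loop_concat g h)) _ _ id phi).
- exact: id_continuous.
- apply: continuous_minR; first exact: scale_continuous.
  by apply: continuous_minR; exact: affine_continuous.
- by rewrite /phi [X in Num.min _ X]min_l; rewrite ?min_l; lra.
- by rewrite /phi [X in Num.min _ X]min_r; rewrite ?min_r; lra.
- by move=> s; rewrite unitI_valK.
- move=> s /=; have /andP[s0 s1] := unitI_itv s; rewrite /concat_fun.
  have [s2|s2] := leP (unitI_val s) 2^-1.
    rewrite (clampK (t := 2 * unitI_val s)); last lra.
    have [s4|s4] := leP (2 * unitI_val s) 2^-1.
      have -> : phi (unitI_val s) = 2 * unitI_val s.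
        by rewrite /phi [X in Num.min _ X]min_l; rewrite ?min_l; lra.
      by rewrite clampK ?s4//; lra.
    have -> : phi (unitI_val s) = unitI_val s + 4^-1.
      by rewrite /phi [X in Num.min _ X]min_l; rewrite ?min_r; lra.
    rewrite clampK; last lra.
    rewrite ifF; last lra.
    rewrite clampK; last lra.
    rewrite ifT; last lra.
    by congr (g (clamp _)); lra.
  have -> : phi (unitI_val s) = 2^-1 * unitI_val s + 2^-1.
    by rewrite /phi [X in Num.min _ X]min_r; rewrite ?min_r; lra.
  rewrite clampK; last lra.
  rewrite ifF; last lra.
  rewrite clampK; last lra.
  rewrite ifF; last lra.
  by congr (h (clamp _)); lra.
Qed.

End loops.

Arguments loop_continuous {R X c x} _.

Section fundamental_group.
Context (R : realType) (X : Type) (c : closure_structure X) (x : X).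

Local Notation loopRcx := (loop R c x).

HB.instance Definition _ := gen_eqMixin loopRcx.
HB.instance Definition _ := gen_choiceMixin loopRcx.

Definition loop_rel : rel loopRcx := fun f g => `[< loop_homotopic f g >].

Let loop_rel_refl : reflexive loop_rel.
Proof. by move=> f; apply/asboolP; exact: loop_homotopic_refl. Qed.

Let loop_rel_sym : symmetric loop_rel.
Proof.
move=> f g; apply/idP/idP => /asboolP fg; apply/asboolP;
  exact: loop_homotopic_sym.
Qed.

Let loop_rel_trans : transitive loop_rel.
Proof.
move=> g f h /asboolP fg /asboolP gh; apply/asboolP.
exact: loop_homotopic_trans fg gh.
Qed.

Canonical loop_equiv := EquivRel loop_rel loop_rel_refl loop_rel_sym loop_rel_trans.

Definition pi1 : Type := {eq_quot loop_rel}.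

HB.instance Definition _ := Choice.on pi1.
HB.instance Definition _ := EqQuotient.on pi1.

Lemma pi1_eqP (f g : loopRcx) : \pi_pi1 f = \pi_pi1 g <-> loop_homotopic f g.
Proof. by split => [/eqmodP/asboolP //|fg]; apply/eqmodP/asboolP. Qed.

Definition pi1_one : pi1 := \pi_pi1 (loop_cst R c x).
Definition pi1_mul (a b : pi1) : pi1 := \pi_pi1 (loop_concat (repr a) (repr b)).
Definition pi1_inv (a : pi1) : pi1 := \pi_pi1 (loop_rev (repr a)).

Let repr_pi (f : loopRcx) : loop_homotopic (repr (\pi_pi1 f)) f.
Proof. by apply/pi1_eqP; rewrite reprK. Qed.

Lemma pi1_mulE (f g : loopRcx) :
  pi1_mul (\pi_pi1 f) (\pi_pi1 g) = \pi_pi1 (loop_concat f g).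
Proof. by apply/pi1_eqP; apply: concat_homotopic; exact: repr_pi. Qed.

Lemma pi1_invE (f : loopRcx) : pi1_inv (\pi_pi1 f) = \pi_pi1 (loop_rev f).
Proof. by apply/pi1_eqP; apply: rev_homotopic; exact: repr_pi. Qed.

Let pi1_mulA : associative pi1_mul.
Proof.
elim/quotW => f; elim/quotW => g; elim/quotW => h.
rewrite (pi1_mulE g h) (pi1_mulE f g) !pi1_mulE.
by apply/pi1_eqP; exact: concatA.
Qed.

Let pi1_mul1 : left_id pi1_one pi1_mul.
Proof.
elim/quotW => f; rewrite pi1_mulE; apply/pi1_eqP; exact: concat_cstl.
Qed.

Let pi1_1mul : right_id pi1_one pi1_mul.
Proof.
elim/quotW => f; rewrite pi1_mulE; apply/pi1_eqP; exact: concat_cstr.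
Qed.

Let pi1_mulV : left_inverse pi1_one pi1_inv pi1_mul.
Proof.
elim/quotW => f; rewrite pi1_invE pi1_mulE; apply/pi1_eqP; exact: concat_revl.
Qed.

Let pi1_Vmul : right_inverse pi1_one pi1_inv pi1_mul.
Proof.
elim/quotW => f; rewrite pi1_invE pi1_mulE; apply/pi1_eqP; exact: concat_revr.
Qed.

HB.instance Definition _ := isGroup.Build pi1
  pi1_mulA pi1_mul1 pi1_1mul pi1_mulV pi1_Vmul.

End fundamental_group.

(* Main.v *)
Require Import Defs.
From mathcomp Require Import all_boot all_order all_algebra.
From mathcomp Require Import all_classical all_reals all_analysis.
From mathcomp Require Import lra.

(** The circle of circumference 1 has diameter 1/2, so for [r >= 1/2] the closure
    [c_r] sends every nonempty set to the whole circle: it is the indiscrete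
    structure ([metric_cl_indiscrete], [circle_mdist_le]). Every map into an
    indiscrete closure space is continuous, in particular every map out of the
    square, so a homotopy between two loops may jump: it can follow the first loop
    at time 0 and the second one at all later times ([indiscrete_homotopic]).
    Hence every loop is null-homotopic. *)

Import Order.TTheory GRing.Theory Num.Theory.

Local Open Scope classical_set_scope.
Local Open Scope ring_scope.
Local Open Scope quotient_scope.

Definition indiscrete (X : Type) (c : closure_structure X) :=
  forall A, A !=set0 -> c A = setT.

Lemma indiscrete_continuous (X Y : Type) (cX : closure_structure X)
    (cY : closure_structure Y) (f : X -> Y) :
  indiscrete Y cY -> cl_continuous cX cY f.
Proof.
move=> cYT A _ [x Ax <-]; rewrite cYT//.
(* The image of A is nonempty because the closure of the empty set is empty. *)
have [A0|/set0P[a Aa]] := eqVneq A set0; first by move: Ax; rewrite A0 cl0.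
by exists (f a), a.
Qed.

Lemma indiscrete_homotopic (R : realType) (X : Type) (c : closure_structure X)
    (x : X) (f g : loop R c x) :
  indiscrete X c -> loop_homotopic f g.
Proof.
move=> cT; exists (fun p => if pselect (p.2 = I0) then f p.1 else g p.1).
split=> [|s|s|t] /=.
- exact: indiscrete_continuous.
- by case: pselect.
- case: pselect => // eqI; have := congr1 (@unitI_val R) eqI.
  by rewrite I0E I1E => /eqP; rewrite oner_eq0.
- by case: pselect => ?; rewrite !loop0 !loop1.
Qed.

Lemma metric_cl_indiscrete (R : realType) (X : metricType R) (r : {nonneg R}) :
  (forall x y : X, mdist x y <= r%:num) -> indiscrete X (metric_cl X r).
Proof.
move=> diam A [a Aa]; apply/seteqP; split=> // x _; split; first by exists a.
apply: le_trans (diam x a); apply: ge_inf; last by exists a.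
by exists 0 => _ [y _ <-]; exact: mdist_ge0.
Qed.

Lemma circle_mdist_le (R : realType) (a b : circle R) : mdist a b <= 2^-1.
Proof.
rewrite -(reprK a) -(reprK b).
set z := repr a - repr b.
(* The integer nearest to z is the floor of z + 1/2. *)
have [_ /(_ (- Num.floor (z + 2^-1))) le_dist] := circle_dist_min (repr a) (repr b).
apply: le_trans le_dist _; rewrite -/z mulrNz ler_norml.
have fl := floor_le (z + 2^-1); have fu := floorD1_gt (z + 2^-1).
by move: fu; rewrite intrD => fu; apply/andP; split; lra.
Qed.

Theorem theorem4p52 (R : realType) (r : {nonneg R}) (x : circle R) :
  2^-1 <= r%:num ->
  [set: pi1 R (metric_cl (circle R) r) x] = [set 1%g].
Proof.
move=> r_ge; apply/seteqP; split=> // u _ /=.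
rewrite -[u]reprK; apply/pi1_eqP/indiscrete_homotopic/metric_cl_indiscrete => a b.
by apply: le_trans r_ge; exact: circle_mdist_le.
Qed.
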